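(* Let $1\leq p<\infty$, let $\kappa$ be a cardinal, and let $(X,\Sigma,\nu)$ be a relatively nonatomic measure space that admits a $\kappa$-separable partition. Then $L^{p}(\nu)$ is isometrically isomorphic to $\ell^{p}(\kappa,L^{p}[0,1])$.
   Context: An atom of $(X,\Sigma,\nu)$ is a set $A\in\Sigma$ with $\nu(A)>0$ such that every measurable $B\subset A$ has $\nu(B)\in\{0,\nu(A)\}$; the space is purely nonatomic if it has no atoms. $(X,\Sigma,\nu)$ is relatively nonatomic if for every $\sigma$-finite $E\in\Sigma$, the restricted space $(E,\{B\cap E:B\in\Sigma\},\nu)$ is purely nonatomic. A measurable set $Y$ is called separable if $L^p(Y,\nu)$ (restricted $\sigma$-algebra and measure) is separable for $1\le p<\infty$. A family $\{X_i: i\in J\}\subset\Sigma$ of $\sigma$-finite separable sets with $\nu(X_i)>0$ is a $\kappa$-separable partition if $|J|=\kappa$, $\nu(X_i\cap X_j)=0$ for distinct $i,j\in J$, and for every $E\in\Sigma$ with $\nu(E)<\infty$ one has $\nu(E)=\sum_{i\in J}\nu(E\cap X_i)$. For a cardinal $\kappa$ and Banach space $Z$, $\ell^{p}(\kappa,Z)$ is the space of families $(z_j)_{j\in J}$, $|J|=\kappa$, with $\sum_j\|z_j\|^p<\infty$ and norm $(\sum_j\|z_j\|^p)^{1/p}$. *)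

(* Defs.v *)
From HB Require Import structures.
From mathcomp Require Import all_boot all_order all_algebra.
From mathcomp Require Import all_classical all_reals all_analysis.
Set Implicit Arguments. Unset Strict Implicit. Unset Printing Implicit Defensive.
Import Order.TTheory GRing.Theory Num.Theory.
Import numFieldNormedType.Exports.
Local Open Scope classical_set_scope.
Local Open Scope ring_scope.

Section defs.
Context d (T : measurableType d) (R : realType).
Implicit Types (nu : {measure set T -> \bar R}).

Definition restr_atom nu (E A : set T) : Prop :=
  (exists B, measurable B /\ A = B `&` E) /\ (0 < nu A)%E /\
  forall C, measurable C -> C `&` E `<=` A ->
    nu (C `&` E) = 0%E \/ nu (C `&` E) = nu A.

Definition restr_purely_nonatomic nu (E : set T) : Prop :=
  forall A, ~ restr_atom nu E A.

Definition relatively_nonatomic nu : Prop :=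
  forall E, measurable E -> sigma_finite E nu -> restr_purely_nonatomic nu E.

(* f belongs to L^p(mu) (as a function; L^p is the quotient mod a.e.) *)
Definition Lp_fun d' (T' : measurableType d') (mu : {measure set T' -> \bar R})
  (p : R) (f : T' -> R) : Prop :=
  measurable_fun setT f /\ finite_norm mu p%:E f.

Definition separable_set nu (Y : set T) : Prop :=
  forall (mY : measurable Y) (p : R), 1 <= p ->
    exists S : set (T -> R), countable S /\
      (forall g, S g -> Lp_fun (mrestr nu mY) p g) /\
      forall f, Lp_fun (mrestr nu mY) p f -> forall eps : R, 0 < eps ->
        exists2 g, S g &
          ((Lnorm (mrestr nu mY) p%:E (EFin \o (fun x => (f x - g x)%R))) < eps%:E)%E.

(* {Xs i | i in J} is a |J|-separable partition *)
Definition separable_partition (J : choiceType) nu (Xs : J -> set T) : Prop :=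
  (forall i, measurable (Xs i)) /\
  (forall i, sigma_finite (Xs i) nu) /\
  (forall i, separable_set nu (Xs i)) /\
  (forall i, (0 < nu (Xs i))%E) /\
  (forall i j, i <> j -> nu (Xs i `&` Xs j) = 0%E) /\
  (forall E, measurable E -> (nu E < +oo)%E ->
     nu E = \esum_(i in [set: J]) nu (E `&` Xs i)).
End defs.

Lemma measurable_itv01 (R : realType) : measurable (`[0%R, 1%R] : set (measurableTypeR R)).
Proof. exact: measurable_itv. Qed.

Definition leb01 (R : realType) : {measure set (measurableTypeR R) -> \bar R} :=
  mrestr (@lebesgue_measure R) (@measurable_itv01 R).

Definition lp_family (R : realType) (J : choiceType) (p : R) (g : J -> measurableTypeR R -> R)
  : Prop :=
  (forall j, Lp_fun (leb01 R) p (g j)) /\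
  (\esum_(j in [set: J]) ((Lnorm (leb01 R) p%:E (EFin \o g j)) `^ p)%E < +oo)%E.

Definition lp_norm (R : realType) (J : choiceType) (p : R) (g : J -> measurableTypeR R -> R)
  : \bar R :=
  ((\esum_(j in [set: J]) ((Lnorm (leb01 R) p%:E (EFin \o g j)) `^ p)%E) `^ p^-1)%E.

(* Phi induces an isometric (linear) isomorphism
   L^p(nu) -> l^p(J, L^p[0,1]) of the quotient spaces (mod a.e. equality) *)
Definition Lp_lp_isometric_iso d (T : measurableType d) (R : realType)
  (nu : {measure set T -> \bar R}) (p : R) (J : choiceType)
  (Phi : (T -> R) -> J -> measurableTypeR R -> R) : Prop :=
  (forall f, Lp_fun nu p f -> lp_family p (Phi f)) /\
  (forall f g (a : R), Lp_fun nu p f -> Lp_fun nu p g -> forall j,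
     Phi (fun x => f x + a * g x) j = (fun t => Phi f j t + a * Phi g j t)
       %[ae leb01 R]) /\
  (forall f g, Lp_fun nu p f -> Lp_fun nu p g -> f = g %[ae nu] ->
     forall j, Phi f j = Phi g j %[ae leb01 R]) /\
  (forall f, Lp_fun nu p f -> (Lnorm (nu) p%:E (EFin \o f)) = lp_norm p (Phi f)) /\
  (forall g, lp_family p g ->
     exists2 f, Lp_fun nu p f & forall j, Phi f j = g j %[ae leb01 R]).

(* Main.v *)
Require Import Defs.
From HB Require Import structures.
From mathcomp Require Import all_boot all_order all_algebra finmap.
From mathcomp Require Import all_classical all_reals all_analysis.
From mathcomp Require Import measurable_realfun lra.
Set Implicit Arguments. Unset Strict Implicit. Unset Printing Implicit Defensive.
Import Order.TTheory GRing.Theory Num.Theory.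
Import numFieldNormedType.Exports.
Local Open Scope classical_set_scope.
Local Open Scope ring_scope.

(* Each piece X_j carries a measurable map phi : X_j -> R and a weight w > 0 such
   that phi pushes w.nu forward to Lebesgue measure on [0,1] and every measurable
   set agrees, up to a null set, with the preimage under phi of a Borel set.
   Then f(x) = w(x)^(1/p) * h(phi(x)) defines an isometry between f in L^p(X_j)
   and h in L^p[0,1], and the L^p norm on X is the l^p sum over the pieces because
   an L^p function lives, up to a null set, on countably many of them.

   To get phi: sigma-finiteness gives w with w.nu a probability; the sets
   {g > 1/2}, for g in a countable dense subset of L^1(X_j), generate the
   sigma-algebra modulo null sets, and are encoded as base-4 digits of a single
   function psi. The fibres of psi would be atoms if they were not null, so psi
   has a continuous distribution function F, and phi = F o psi is uniform. *)

(** * Restricted measures and gluing along countably many disjoint sets *)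

Section measure_tools.
Context d (T : measurableType d) (R : realType).
Implicit Types mu nu : {measure set T -> \bar R}.

Lemma ge0_integral_mrestr mu (D : set T) (mD : measurable D) (f : T -> \bar R) :
  measurable_fun setT f -> (forall x, 0 <= f x)%E ->
  (\int[mrestr mu mD]_x f x = \int[mu]_(x in D) f x)%E.
Proof.
move=> mf f0; rewrite [LHS](ge0_negligible_integral (N := ~` D))//=; last 2 first.
- exact: measurableC.
- by rewrite /mrestr setICl measure0.
rewrite setTD setCK; apply: eq_measure_integral => A mA AD.
by rewrite /= /mrestr setIidl.
Qed.

Lemma ae_mrestrP mu (D : set T) (mD : measurable D) (P : set T) :
  {ae mrestr mu mD, forall x, P x} <-> {ae mu, forall x, D x -> P x}.
Proof.
split=> [[N [mN N0 PN]]|[N [mN N0 PN]]].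
- exists (N `&` D); split=> //; first exact: measurableI.
  by move=> x /= /not_implyP[Dx Px]; split => //; exact: PN.
- exists (N `|` ~` D); split.
  + by apply: measurableU => //; exact: measurableC.
  + rewrite /= /mrestr setIUl setICl setU0.
    by apply: subset_measure0 N0 => //; exact: measurableI.
  + move=> x /= Px; have [Dx|] := pselect (D x); last by right.
    by left; apply: PN => /=; apply/not_implyP.
Qed.

(** Disjointness makes the chosen index the only possible one, so the result does not depend on the
    choice. Measurability is checked on each [F n] and on the complement of their union. *)
Lemma measurable_glue d' (U : measurableType d') (F : (set T)^nat)
    (u : nat -> T -> U) (c : U) :
  (forall n, measurable (F n)) -> trivIset setT F ->
  (forall n, measurable_fun setT (u n)) ->
  exists f : T -> U, [/\ measurable_fun setT f,
    forall n x, F n x -> f x = u n x &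
    forall x, ~ (\bigcup_n F n) x -> f x = c].
Proof.
move=> mF tF mu.
pose f x := if pselect (exists n, F n x) is left e
  then u (projT1 (cid e)) x else c.
have fE n x : F n x -> f x = u n x.
  move=> Fnx; rewrite /f; case: pselect => [e|]; last by case; exists n.
  case: cid => m /= Fmx; congr (u _ x).
  by apply: contrapT => /eqP mn; have /trivIsetP /(_ m n I I mn) := tF;
     move=> /seteqP[+ _] => /(_ x); apply.
have fN x : ~ (\bigcup_n F n) x -> f x = c.
  by rewrite /f; case: pselect => // -[n Fn] []; exists n.
exists f; split => //.
have mUF : measurable (\bigcup_n F n) by exact: bigcup_measurable.
rewrite -(setUv (\bigcup_n F n)); apply/measurable_funU => //.
  exact: measurableC.
split.
  apply/measurable_fun_bigcup => // n.
  apply: (eq_measurable_fun (u n)) => [x /set_mem /fE //|].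
  exact: measurable_funTS.
apply: (eq_measurable_fun (cst c)) => [x /set_mem /fN //|].
exact: measurable_cst.
Qed.

End measure_tools.

(** * A probability with the same null sets as a sigma-finite restriction *)

Section normalising_density.
Context d (T : measurableType d) (R : realType).
Variable nu : {measure set T -> \bar R}.
Local Open Scope ereal_scope.

(** [Y] is cut into disjoint pieces [F n] of finite measure, and [nu] is rescaled on each by a
    positive constant small enough for the total mass to be finite. After normalisation the density
    is constant on each piece. Outside [Y] it takes the harmless value 1, which keeps [w] positive
    everywhere. *)
Lemma sigma_finite_probability_density (Y : set T) :
  measurable Y -> sigma_finite Y nu -> 0 < nu Y ->
  exists (w : T -> R) (P : probability T R),
    [/\ measurable_fun setT w, (forall x, 0 < w x)%R,
      (forall A, measurable A -> P A = 0 <-> nu (A `&` Y) = 0) &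
      (forall f, measurable_fun setT f -> (forall x, 0 <= f x) ->
        \int[P]_x f x = \int[nu]_(x in Y) ((w x)%:E * f x))].
Proof.
move=> mY [F0 YF0 F0oo] nuY0.
pose F := seqDU F0.
have mF n : measurable (F n).
  by apply: seqDU_measurable => k; exact: (F0oo k).1.
have tF : trivIset setT F by exact: trivIset_seqDU.
have YF : Y = \bigcup_n F n by rewrite YF0 seqDU_bigcup_eq.
have Foo n : nu (F n) < +oo.
  apply: le_lt_trans (F0oo n).2.
  apply: le_measure; rewrite ?inE//; first exact: (F0oo n).1.
  exact: subset_seqDU.
have Ffin n : nu (F n) \is a fin_num by rewrite ge0_fin_numE.
(* The denominator bounds the new mass of [F n] by [1 / 2 ^+ n.+1], and adding 1 avoids dividing by
   zero on a null piece. *)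
pose c n : R := ((1 / 2 ^+ n.+1) / (1 + fine (nu (F n))))%R.
have c0 n : (0 < c n)%R.
  apply: divr_gt0; first by rewrite divr_gt0// exprn_gt0.
  by apply: ltr_wpDr => //; exact: fine_ge0.
pose cn n : {nonneg R} := NngNum (ltW (c0 n)).
pose m_ n : {measure set T -> \bar R} := mscale (cn n) (mrestr nu (mF n)).
pose m : {measure set T -> \bar R} := mseries m_ 0.
have mE A : m A = \sum_(n <oo) (c n)%:E * nu (A `&` F n) by [].
have m0 A : measurable A -> m A = 0 <-> nu (A `&` Y) = 0.
  move=> mA.
  have mAF n : measurable (A `&` F n) by exact: measurableI.
  have nuE : nu (A `&` Y) = \sum_(n <oo) nu (A `&` F n).
    rewrite YF setI_bigcupr measure_bigcup//; last first.
      exact: trivIset_setIl.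
    by apply: eq_eseriesl => n; rewrite in_setT.
  rewrite mE nuE; split => s0.
  - apply: eseries0 => n _ _.
    have : \sum_(n <oo) (c n)%:E * nu (A `&` F n) >= (c n)%:E * nu (A `&` F n).
      rewrite (nneseriesD1 (n := n))//; last by move=> k _; rewrite mule_ge0// lee_fin ltW.
      by rewrite leeDl// nneseries_ge0// => k _ _; rewrite mule_ge0// lee_fin ltW.
    rewrite s0 => cn0; apply/eqP; rewrite -measure_le0.
    by rewrite -(pmule_rle0 _ (_ : 0 < (c n)%:E))// lte_fin.
  - apply: eseries0 => n _ _.
    have : \sum_(n <oo) nu (A `&` F n) >= nu (A `&` F n).
      by rewrite (nneseriesD1 (n := n))// leeDl// nneseries_ge0.
    by rewrite s0 measure_le0 => /eqP ->; rewrite mule0.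
have mTgt0 : 0 < m setT.
  rewrite lt0e measure_ge0 andbT; apply/eqP => /(m0 _ measurableT).
  by rewrite setTI => nuYE; rewrite nuYE ltxx in nuY0.
have mTle1 : m setT <= 1.
  (* Applied to the zero sequence, this is the bound on the geometric series. *)
  have := @epsilon_trick R (cst 0) 1%R xpredT (fun=> lexx 0) ler01.
  rewrite [X in X + _]eseries0// add0e; apply: le_trans.
  rewrite mE; apply: lee_nneseries => [n _ _|n _].
    by rewrite mule_ge0// lee_fin ltW.
  rewrite setTI add0e -[nu _]fineK// -EFinM lee_fin /c natrX.
  have /fine_ge0 y0 := measure_ge0 nu (F n).
  set a := (_ / _ ^+ _)%R; have a0 : (0 <= a)%R by rewrite divr_ge0// exprn_ge0.
  rewrite -mulrA; apply: ler_piMr => //.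
  by rewrite mulrC ler_pdivrMr ?ltr_wpDr// mul1r lerDr.
have mTfin : m setT \is a fin_num by rewrite ge0_fin_numE// (le_lt_trans mTle1)// ltry.
pose M := fine (m setT).
have M0 : (0 < M)%R by rewrite fine_gt0// mTgt0 (le_lt_trans mTle1)// ltry.
have [w [mw wE wN]] := measurable_glue (u := fun n => cst (c n / M)%R) (1%R : R)
  mF tF (fun n => measurable_cst _).
(* [mnormalize] falls back on [P0] only for total mass zero or infinity, which [mTgt0] and [mTle1]
   exclude. *)
pose P0 : probability T R := @dirac _ T point R.
pose P : probability T R := mnormalize m P0.
have PE A : P A = m A * (M^-1)%:E.
  rewrite /P /= /mnormalize ifF//; apply/negbTE; rewrite negb_or.
  by rewrite gt_eqF//= lt_eqF// (le_lt_trans mTle1)// ltry.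
pose Mn : {nonneg R} := NngNum (ltW (etrans (invr_gt0 M) M0)).
have w0 x : (0 < w x)%R.
  have [[n _ Fnx]|/wN ->//] := pselect ((\bigcup_n F n) x).
  by rewrite (wE n)//= divr_gt0.
exists w, P; split => //.
- move=> A mA; rewrite PE -m0//; split => [/eqP|->]; last by rewrite mul0e.
  by rewrite mule_eq0 eqe invr_eq0 (gt_eqF M0) orbF => /eqP.
- move=> f mf f0.
  rewrite [LHS](eq_measure_integral (mscale Mn m)); last first.
    by move=> A mA _ /=; rewrite PE /mscale/= muleC.
  rewrite ge0_integral_mscale//= ge0_integral_measure_series//.
  rewrite -nneseriesZl//; last by move=> n _; exact: integral_ge0.
  rewrite YF ge0_integral_bigcup//=; last 2 first.
  + apply: measurable_funTS; apply: emeasurable_funM => //.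
    exact/measurable_EFinP.
  + by move=> x _; rewrite mule_ge0// lee_fin ltW.
  apply: eq_eseriesr => n _.
  rewrite ge0_integral_mscale//= ge0_integral_mrestr//.
  rewrite muleA -EFinM -ge0_integralZl//; last 2 first.
  + exact: measurable_funTS.
  + by rewrite lee_fin mulr_ge0// ?invr_ge0 ltW.
  by apply: eq_integral => x /set_mem Fnx; rewrite (wE n)//= mulrC.
Qed.
End normalising_density.

(** * Coding countably many sets by one real function *)

Section binary_encoding.
Context (R : realType).
Implicit Types b : nat -> bool.

(* Base 4 rather than 2, so that the tail is below 1 and the first digit can be
   read off as [1 <= encode b]. *)
Definition encode_series b : \bar R :=
  (\sum_(k <oo) ((b k)%:R / 4 ^+ k)%:E)%E.

Definition encode b : R := fine (encode_series b).

(** On codes this deletes the leading digit: the digit is read off by comparison with 1, subtracted,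
    and the rest is rescaled. *)
Definition encode_shift (t : R) : R := 4 * (t - (1 <= t)%R%:R).

Let term_ge0 b k : (0 <= ((b k)%:R / 4 ^+ k : R)%:E)%E.
Proof. by rewrite lee_fin divr_ge0// exprn_ge0. Qed.

Lemma encode_series_ge0 b : (0 <= encode_series b)%E.
Proof. by apply: nneseries_ge0 => k _ _. Qed.

Lemma encode_series_le2 b : (encode_series b <= 2%:E)%E.
Proof.
have := @epsilon_trick R (cst 0%E) 2 xpredT (fun=> lexx 0%E) (ler0n _ _).
rewrite [X in (X + _)%E]eseries0// add0e; apply: le_trans.
apply: lee_nneseries => // k _.
(* The bounding term [2 / 2 ^ k.+1] simplifies to [1 / 2 ^ k], which dominates [1 / 4 ^ k]. *)
rewrite add0e lee_fin expnS natrM invfM mulrA divff// mul1r natrX.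
apply: (@le_trans _ _ (1 / 4 ^+ k)).
  by rewrite ler_pM2r ?invr_gt0 ?exprn_gt0//; case: (b k).
by rewrite div1r lef_pV2 ?posrE ?exprn_gt0// lerXn2r ?nnegrE// ler_nat.
Qed.

Lemma encode_series_fin b : encode_series b \is a fin_num.
Proof.
by rewrite ge0_fin_numE ?encode_series_ge0// (le_lt_trans (encode_series_le2 b))// ltry.
Qed.

Lemma encode_ge0 b : 0 <= encode b.
Proof. by apply: fine_ge0; exact: encode_series_ge0. Qed.

Lemma encode_le2 b : encode b <= 2.
Proof. by rewrite -lee_fin fineK ?encode_series_fin// encode_series_le2. Qed.

Lemma encode_recl b : encode b = (b 0%N)%:R + encode (fun k => b k.+1) / 4.
Proof.
apply: EFin_inj; rewrite EFinD EFinM !fineK ?encode_series_fin//.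
rewrite {1}/encode_series nneseries_recl// expr0 divr1; congr (_ + _)%E.
rewrite -nneseries_addn// muleC /encode_series -nneseriesZl//.
apply: eq_eseriesr => k _; rewrite addn1 -EFinM; congr EFin.
by rewrite exprS invfM mulrCA.
Qed.

Lemma encode_ge1 b : (1 <= encode b) = b 0%N.
Proof.
rewrite encode_recl; have := encode_ge0 (fun k => b k.+1).
have := encode_le2 (fun k => b k.+1); case: (b 0%N) => /= x2 x0.
  by apply/idP; lra.
by apply/negbTE; rewrite -ltNge; lra.
Qed.

Lemma encode_shiftE b : encode_shift (encode b) = encode (fun k => b k.+1).
Proof. by rewrite /encode_shift encode_ge1 encode_recl; lra. Qed.

Lemma iter_encode_shift n b :
  iter n encode_shift (encode b) = encode (fun k => b (n + k)%N).
Proof.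
elim: n => [|n IH]//=; rewrite IH encode_shiftE; congr encode.
by apply/funext => k; rewrite addnS.
Qed.

Lemma measurable_encode_shift : measurable_fun setT encode_shift.
Proof.
apply: measurable_funM => //; apply: measurable_funB => //.
rewrite (_ : (fun t : R => _) = (\1_(`[1, +oo[ : set R) : R -> R)).
  exact: measurable_indic.
by apply/funext => t; rewrite indicE mem_setE in_itv/= andbT.
Qed.

Lemma measurable_iter_encode_shift n : measurable_fun setT (iter n encode_shift).
Proof.
elim: n => [|n IH]/=; first exact: measurable_id.
exact: (measurableT_comp measurable_encode_shift IH).
Qed.

(** The digits of [psi x] record which [A k] contain [x]. After [n] shifts digit [n] is in front, so
    the codes that reach at least 1 are exactly those of points of [A n]. *)
Lemma countable_family_encoding d (T : measurableType d) (A : (set T)^nat) :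
  (forall n, measurable (A n)) ->
  exists psi : T -> R, measurable_fun setT psi /\
    forall n, exists2 C : set R, measurable C & psi @^-1` C = A n.
Proof.
move=> mA; pose psi x := encode (fun k => x \in A k).
exists psi; split.
  apply: (measurableT_comp (fine_measurable _)) => //.
  apply: (@ge0_emeasurable_sum _ _ _ _ (fun k x => ((x \in A k)%:R / 4 ^+ k)%:E) xpredT).
    by move=> k x _ _; exact: (term_ge0 (fun k => x \in A k)).
  move=> k _; apply/measurable_EFinP; apply: measurable_funM => //.
  rewrite (_ : (fun x => _) = (\1_(A k) : T -> R)); first exact: measurable_indic.
  by apply/funext => x; rewrite indicE.
move=> n; exists (iter n encode_shift @^-1` `[1, +oo[).
  rewrite -[X in measurable X]setTI; apply: measurable_iter_encode_shift => //.
apply/seteqP; split=> x /=; rewrite in_itv/= andbT iter_encode_shift encode_ge1 addn0.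
  exact: set_mem.
exact: mem_set.
Qed.

End binary_encoding.

(** * Sets recovered from a map up to null sets *)

Section ae_pullback.
Context d (T : measurableType d) (R : realType) d' (U : measurableType d').
Variables (mu : {measure set T -> \bar R}) (f : T -> U).

(** This is the sigma-algebra generated by [f], enlarged by null modifications. Its closure under
    complements and countable unions allows membership to be checked on generators. *)
Definition ae_pullback : set (set T) := [set B | exists2 D : set U,
  measurable D & {ae mu, forall x, B x <-> D (f x)}].

Lemma ae_pullbackC B : ae_pullback B -> ae_pullback (~` B).
Proof.
move=> [D mD BD]; exists (~` D); first exact: measurableC.
by apply: filterS BD => x h; split=> Nx Hx; apply: Nx; exact/h.
Qed.

Lemma ae_pullback_bigcup (B : (set T)^nat) :
  (forall n, ae_pullback (B n)) -> ae_pullback (\bigcup_n B n).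
Proof.
move=> /(_ _)/cid2 hB; exists (\bigcup_n s2val (hB n)).
  by apply: bigcup_measurable => n _; exact: s2valP (hB n).
have : {ae mu, forall x, forall n, B n x <-> s2val (hB n) (f x)}.
  by apply: ae_foralln => n; exact: s2valP' (hB n).
by apply: filterS => x h; split=> -[n _ Bn]; exists n => //; exact/h.
Qed.

End ae_pullback.

(** * A uniform variable from a continuous distribution function *)

Lemma borel_generated_by_rays (R : realType) (D : set R) :
  measurable D -> <<s @RGenOInfty.G R >> D.
Proof.
move=> mD; have : (@ocitv R).-sigma.-measurable D by exact: mD.
by rewrite RGenOInfty.measurableE.
Qed.

Section probability_integral_transform.
Context d (T : measurableType d) (R : realType) (P : probability T R).
Variable X : {RV P >-> R}.
Hypothesis nonatomic : forall t, P (X @^-1` [set t]) = 0%E.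

Let F t := fine (cdf X t).

Let cdf_fin t : cdf X t \is a fin_num.
Proof. exact: fin_num_measure. Qed.

Let FE t : (F t)%:E = cdf X t. Proof. by rewrite fineK. Qed.

Let F_homo s t : s <= t -> F s <= F t.
Proof. by move=> st; rewrite -lee_fin !FE; exact: cdf_nondecreasing. Qed.

Let F_ge0 t : 0 <= F t. Proof. by rewrite -lee_fin FE cdf_ge0. Qed.
Let F_le1 t : F t <= 1. Proof. by rewrite -lee_fin FE cdf_le1. Qed.

Let measurable_F : measurable_fun setT F.
Proof. exact: nondecreasing_measurable. Qed.

(** The value is attained at the supremum of the points where [F] is at most [a]; the limits of [F]
    at both infinities make this set nonempty and bounded. Null fibres give continuity from the
    left, and right continuity holds for every distribution function. *)
Let F_surjective (a : R) : 0 < a < 1 -> exists t, F t = a.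
Proof.
move=> /andP[a0 a1]; pose S := [set s | F s <= a].
have Sdown s t : s <= t -> S t -> S s by move=> /F_homo Fst /(le_trans Fst).
have S0 : S !=set0.
  have /fine_cvgP[_ /cvgr_lt /(_ _ a0)] := cvg_cdfNy0 X.
  by move=> [M [Mr /(_ (M - 1))]]; rewrite ltrBlDr ltrDl ltr01 => /(_ isT) /ltW FM;
    exists (M - 1).
have [M SM] : exists M, ~ S M.
  have /fine_cvgP[_ /cvgr_gt /(_ _ a1)] := cvg_cdfy1 X.
  move=> [M [Mr /(_ (M + 1))]]; rewrite ltrDl ltr01 => /(_ isT) FM.
  by exists (M + 1); apply/negP; rewrite -ltNge.
have ubM : ubound S M.
  by move=> s Ss; rewrite leNgt; apply/negP => /ltW Ms; exact/SM/(Sdown _ _ Ms).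
have supS : has_sup S by split => //; exists M.
exists (sup S); set t := sup S; apply/eqP; rewrite eq_le; apply/andP; split.
  rewrite -lee_fin FE /cdf /distribution /pushforward.
  (* The ray up to [t] is the increasing union of these sets and the null fibre at [t]; each of them
     has measure at most [a]. *)
  pose E n := X @^-1` `]-oo, t - n.+1%:R^-1].
  have mE n : measurable (E n) by exact: measurable_funPTI.
  have mUE : measurable (\bigcup_n E n) by exact: bigcup_measurable.
  have mXt : measurable (X @^-1` [set t]) by exact: measurable_funPTI.
  have -> : X @^-1` `]-oo, t] = \bigcup_n E n `|` X @^-1` [set t].
    apply/seteqP; split=> x /=; rewrite ?in_itv/=.
      rewrite le_eqVlt => /predU1P[->|Xt]; [by right|left].
      have [n Hn] := ltr_add_invr Xt.
      by exists n => //; rewrite /E/= in_itv/= lerBrDr ltW.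
    move=> [[n _]|->//]; rewrite /E/= in_itv/= => /le_trans; apply.
    by rewrite lerBlDr lerDl.
  rewrite measureU0//; last exact: nonatomic.
  have := nondecreasing_cvg_mu mE mUE; move=> /(_ _ P) cvE.
  apply: (cvge_to_le (cvE _)).
    move=> m n mn; apply/subsetPset => x /=; rewrite /E/= !in_itv/= => /le_trans; apply.
    by rewrite lerD2l lerN2 lef_pV2 ?posrE// ler_nat.
  apply: nearW => n /=.
  have [|s Ss ts] := @sup_adherent _ S n.+1%:R^-1 _ supS; first by rewrite invr_gt0.
  by have := Sdown _ _ (ltW ts) Ss; rewrite /S/= -lee_fin FE.
rewrite -lee_fin FE.
apply: (cvge_to_ge (@cdf_right_continuous _ _ _ _ X t)).
(* A point [r] to the right of the supremum is outside [S], hence [F r] exceeds [a]. *)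
near=> r; rewrite -FE lee_fin ltW// ltNge; apply/negP => Sr.
have : r <= t by apply: ub_le_sup => //; exists M.
by apply/negP; rewrite -ltNge; near: r; exact: nbhs_right_gt.
Unshelve. all: by end_near. Qed.

Let phi x := F (X x).

Let measurable_phi : measurable_fun setT phi.
Proof. exact: measurableT_comp. Qed.

(** The set is compared with rays of [X] ending at points where [F] has a prescribed value. The
    upper bound goes through the value [a + e], because [F] may stay equal to [a] beyond a point
    where it attains [a]. *)
Let phi_itvNyc (a : R) : 0 <= a < 1 -> P (phi @^-1` `]-oo, a]) = a%:E.
Proof.
move=> /andP[a0 a1].
have mpre (D : set R) : measurable D -> measurable (phi @^-1` D).
  by move=> mD; rewrite -[X in measurable X]setTI; exact: measurable_phi.
apply/eqP; rewrite eq_le; apply/andP; split.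
  apply/lee_addgt0Pr => e e0.
  have [ae1|ae1] := leP 1 (a + e).
    by apply: le_trans (probability_le1 _ _) _; [exact: mpre|rewrite -EFinD lee_fin].
  have [|s Fs] := @F_surjective (a + e); first by rewrite ae1 andbT ltr_wpDl.
  rewrite -EFinD -Fs FE; apply: le_measure; rewrite ?inE.
  - exact: mpre.
  - exact: measurable_funPTI.
  - move=> x /=; rewrite !in_itv/= leNgt => xa; rewrite leNgt; apply/negP => /ltW /F_homo.
    by move: xa; rewrite Fs -leNgt /phi; lra.
have [a_le0|a_gt0] := leP a 0.
  by apply: le_trans (measure_ge0 _ _); rewrite lee_fin.
have [|s Fs] := @F_surjective a; first by rewrite a_gt0.
rewrite [leLHS](_ : _ = P (X @^-1` `]-oo, s])); last by rewrite -Fs FE.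
apply: le_measure; rewrite ?inE.
- exact: measurable_funPTI.
- exact: mpre.
- by move=> x /=; rewrite !in_itv/= => /F_homo; rewrite Fs.
Qed.

Let leb01T : leb01 R setT = 1%E.
Proof.
by rewrite /leb01/= /mrestr setTI lebesgue_measure_itv/= lte_fin ltr01 oppr0 adde0.
Qed.

Let leb01C (D : set (measurableTypeR R)) : measurable D ->
  leb01 R (~` D) = (1 - leb01 R D)%E.
Proof.
move=> mD; have T1 : (leb01 R setT < +oo)%E by rewrite leb01T ltry.
by rewrite -setTD measureD// setTI; congr (_ - _)%E; exact: leb01T.
Qed.

Let leb01_itvNyc (a : R) : 0 <= a < 1 -> leb01 R (`]-oo, a]%classic : set R) = a%:E.
Proof.
move=> /andP[a0 a1]; rewrite /leb01/= /mrestr.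
rewrite (_ : _ `&` _ = `[0%R, a]%classic); last first.
  apply/seteqP; split => x /=; rewrite !in_itv/=; first by move=> [-> /andP[->]].
  by move=> /andP[-> xa]; split => //; rewrite (le_trans xa)// ltW.
rewrite lebesgue_measure_itv/= lte_fin oppr0 adde0.
by case: ltP => // a0'; congr EFin; apply/eqP; rewrite eq_le a0 a0'.
Qed.

Let phi_law_ray a : P (phi @^-1` `]a, +oo[) = leb01 R (`]a, +oo[%classic : set R).
Proof.
have mpre (D : set R) : measurable D -> measurable (phi @^-1` D).
  by move=> mD; rewrite -[X in measurable X]setTI; exact: measurable_phi.
have -> : `]a, +oo[%classic = ~` `]-oo, a]%classic :> set R by rewrite setCitvl.
have mray : measurable (`]-oo, a]%classic : set (measurableTypeR R)).
  exact: measurable_itv.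
have -> : P (phi @^-1` (~` `]-oo, a])) = (1 - P (phi @^-1` `]-oo, a]))%E.
  exact: probability_setC (mpre _ mray).
rewrite leb01C//; congr (_ - _)%E.
have [a0|a0] := ltP a 0.
  rewrite /leb01/= /mrestr (_ : _ `&` _ = set0); last first.
    by rewrite -subset0 => x /=; rewrite !in_itv/= => -[xa /andP[x0 _]]; lra.
  rewrite (_ : phi @^-1` _ = set0) ?measure0//.
  by rewrite -subset0 => x /=; rewrite in_itv/=; have := F_ge0 (X x); rewrite /phi; lra.
have [a1|a1] := ltP a 1; first by rewrite phi_itvNyc ?leb01_itvNyc ?a0.
rewrite (_ : phi @^-1` _ = setT); last first.
  by rewrite -subTset => x _ /=; rewrite in_itv/=; exact: le_trans (F_le1 _) a1.
rewrite probability_setT -leb01T /leb01/= /mrestr setTI setIidr//.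
by move=> x /=; rewrite !in_itv/= => /andP[_ /le_trans]; apply.
Qed.

(** Rays form a generating family closed under intersection, so the law of [phi] is settled by
    [phi_law_ray]. Composition with [F] merges points on flat stretches of [F], but these carry no
    mass, so up to null sets [phi] retains every event that [X] determines. *)
Lemma nonatomic_uniformisation : exists phi : T -> measurableTypeR R,
  [/\ measurable_fun setT phi,
    forall D, measurable D -> P (phi @^-1` D) = leb01 R D &
    forall D : set R, measurable D -> ae_pullback P phi (X @^-1` D)].
Proof.
pose phi' : T -> measurableTypeR R := phi.
have mphi' : measurable_fun setT phi' by exact: measurable_phi.
exists phi'.
have law D : measurable D -> P (phi' @^-1` D) = leb01 R D.
  move=> mD.
  pose phiM : {mfun T >-> measurableTypeR R} :=
    HB.pack phi' (isMeasurableFun.Build _ _ _ _ _ mphi').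
  pose g (n : nat) : set (measurableTypeR R) := (`]- (n%:R : R), +oo[%classic : set R).
  apply: (@g_sigma_algebra_measure_unique _ R (measurableTypeR R) (@RGenOInfty.G R)
    _ g _ _ (pushforward P phiM) (leb01 R)).
  - by move=> _ [x ->]; exact: measurable_itv.
  - by move=> n; exists (- n%:R).
  - rewrite -subTset => x _; exists (Num.truncn (- (x : R))).+1 => //.
    by rewrite /g/= in_itv/= andbT ltrNl truncnS_gt.
  - move=> _ _ [x ->] [y ->]; exists (Num.max x y).
    by apply/seteqP; split=> z /=; rewrite !in_itv/= !andbT gt_max => /andP.
  - by move=> _ [x ->]; exact: phi_law_ray.
  - move=> n; apply: (@le_lt_trans _ _ 1%E); last exact: (ltry 1).
    by apply: probability_le1; apply: measurable_funPTI; exact: measurable_itv.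
  - exact: borel_generated_by_rays.
split => // D mD.
(* [K] is a sigma-algebra, so it is enough that it contains the rays. *)
pose K := [set B : set R | ae_pullback P phi' (X @^-1` B)].
suff /(_ _ (borel_generated_by_rays mD)) : <<s @RGenOInfty.G R >> `<=` K by [].
apply: smallest_sub.
  rewrite /K; split => [|A|A] /=.
  - by rewrite preimage_set0; exists set0 => //; apply: aeW.
  - by rewrite setTD preimage_setC; exact: ae_pullbackC.
  - by move=> h; rewrite preimage_bigcup; exact: ae_pullback_bigcup.
move=> _ [a ->]; rewrite /K/=.
exists (`]F a, +oo[%classic : set R); first exact: measurable_itv.
have mpre (A : set R) : measurable A -> measurable (phi @^-1` A).
  by move=> mA; rewrite -[X in measurable X]setTI; exact: measurable_phi.
have mXa : measurable (X @^-1` `]a, +oo[) by exact: measurable_funPTI.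
have Fa : P (phi @^-1` `]-oo, F a]) = (F a)%:E.
  have := F_le1 a; rewrite le_eqVlt => /predU1P[Fa1|Fa1].
    rewrite Fa1 (_ : phi @^-1` _ = setT) ?probability_setT//.
    by rewrite -subTset => x _ /=; rewrite in_itv/=; exact: F_le1.
  by rewrite phi_itvNyc// F_ge0.
(* One inclusion holds by monotonicity, and both sets have measure 1 - F a. *)
have phiX : phi @^-1` `]F a, +oo[ `<=` X @^-1` `]a, +oo[.
  move=> x /=; rewrite !in_itv/= !andbT ltNge => xa; rewrite ltNge.
  by apply: contra xa => /F_homo.
exists (X @^-1` `]a, +oo[ `\` phi @^-1` `]F a, +oo[); split.
- by apply: measurableD => //; apply: mpre; exact: measurable_itv.
- rewrite measureD//; last 2 first.
    by exact: (mpre _ (measurable_itv _)).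
    by apply: (@le_lt_trans _ _ 1%E); [exact: probability_le1|exact: (ltry 1)].
  rewrite setIidr//.
  have PC (A : set T) (B : set T) : measurable B -> A = ~` B -> P A = (1 - P B)%E.
    by move=> mB ->; exact: probability_setC.
  have E1 : P (X @^-1` `]a, +oo[) = (1 - (F a)%:E)%E.
    rewrite (PC _ (X @^-1` `]-oo, a])) ?FE//.
      by apply: measurable_funPTI; exact: measurable_itv.
    by rewrite preimage_setC setCitvl.
  have E2 : P (phi @^-1` `]F a, +oo[) = (1 - (F a)%:E)%E.
    rewrite (PC _ (phi @^-1` `]-oo, F a])) ?Fa//.
      exact: (mpre _ (measurable_itv _)).
    by rewrite preimage_setC setCitvl.
  transitivity ((1 - (F a)%:E) - (1 - (F a)%:E))%E; last by rewrite -!EFinB subrr.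
  by congr (_ - _)%E; [exact: E1|exact: E2].
- by move=> x /= h; split => [|xa]; [apply: contrapT => nXa|];
    apply: h; split => // /phiX.
Qed.

End probability_integral_transform.

(** * Separability yields one function generating the sigma-algebra modulo null sets *)

Lemma countable_enumeration (U : Type) (S : set U) (x0 : U) : countable S ->
  exists e : nat -> U, (forall n, S (e n) \/ e n = x0) /\
    forall x, S x -> exists n, e n = x.
Proof.
move=> /countable_injP[c cinj].
pose e n := if pselect (exists x, S x /\ c x = n) is left h
  then projT1 (cid h) else x0.
exists e; split => [n|x Sx].
  by rewrite /e; case: pselect => [h|_]; [left; case: cid => x []|right].
exists (c x); rewrite /e; case: pselect => [h|[]]; last by exists x.
by case: cid => y [/= Sy cyx]; apply: cinj => //; exact: mem_set.
Qed.

Section separable_generation.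
Context d (T : measurableType d) (R : realType).
Variable nu : {measure set T -> \bar R}.

(** Only the exponent 1 is used. The indicator of a set of finite measure is approximated in L^1 by
    members of the dense sequence, so fast that by Borel-Cantelli the set is almost everywhere an
    upper limit of sets [A n]. Sigma-finiteness of [Y] then reaches all measurable sets. *)
Lemma separable_ae_generated (Y : set T) (mY : measurable Y) :
  sigma_finite Y nu -> separable_set nu Y ->
  exists psi : T -> R, measurable_fun setT psi /\
    forall B, measurable B -> ae_pullback (mrestr nu mY) psi B.
Proof.
move=> [F YF Foo] /(_ mY 1 (lexx 1))[S [cS [SL1 Sdense]]].
set m := mrestr nu mY in SL1 Sdense *.
have [e [eS eonto]] := countable_enumeration (cst 0) cS.
have me n : measurable_fun setT (e n).
  have [/SL1[]//|->] := eS n; exact: measurable_cst.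
(* If |1_B - g| < 1/2 at x, then x is in B exactly when g x > 1/2. *)
pose A n := e n @^-1` `]2^-1, +oo[.
have mA n : measurable (A n).
  by rewrite -[A n]setTI; apply: me => //; exact: measurable_itv.
have [psi [mpsi psiA]] := countable_family_encoding R mA.
exists psi; split => // B mB.
have {}psiA n : ae_pullback m psi (A n).
  by have [C mC CA] := psiA n; exists C => //; apply: aeW => x; rewrite -CA.
have finite_case B' : measurable B' -> (m B' < +oo)%E -> ae_pullback m psi B'.
  clear B mB => {}mB B'oo.
  pose f : T -> R := \1_B'.
  have mf : measurable_fun setT f by exact: measurable_indic.
  have fL1 : Lp_fun m 1 f.
    split => //; rewrite /finite_norm Lnorm1.
    rewrite (_ : (fun x => _) = (fun x => (\1_B' x)%:E)).
      by rewrite integral_indic// setIT.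
    by apply/funext => x /=; rewrite ger0_norm// indicE.
  (* The factor [2^-1] cancels against the threshold in Markov's inequality and leaves a summable
     bound on the exceptional sets. *)
  pose eps k : R := 2^-1 * (1 / (2 ^ k.+1)%:R).
  have eps0 k : 0 < eps k.
    by rewrite /eps mulr_gt0// divr_gt0// ltr0n expn_gt0.
  have close k : exists n, (m [set x | (2^-1)%:E <= `|(f x - e n x)%:E|] <=
      (1 / (2 ^ k.+1)%:R)%:E)%E.
    have [g Sg] := Sdense f fL1 _ (eps0 k); rewrite Lnorm1.
    have [n <-] := eonto g Sg; move=> fg; exists n.
    have mfe : measurable_fun setT (fun x => (f x - e n x)%:E).
      by apply/measurable_EFinP; exact: measurable_funB.
    have half0 : 0 < 2^-1 :> R by [].
    have := le_integral_abse m measurableT mfe half0; rewrite setTI.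
    move=> /le_lt_trans /(_ fg); rewrite /eps EFinM lte_pmul2l// => /ltW; exact.
  pose n_ k := projT1 (cid (close k)).
  pose N k := [set x | (2^-1)%:E <= `|(f x - e (n_ k) x)%:E|]%E.
  have mN k : measurable (N k).
    have mh : measurable_fun setT (fun x => `|f x - e (n_ k) x|).
      by apply: measurableT_comp => //; exact: measurable_funB.
    rewrite (_ : N k = (fun x => `|f x - e (n_ k) x|) @^-1` `[2^-1, +oo[).
      by rewrite -[X in measurable X]setTI; apply: mh => //; exact: measurable_itv.
    by apply/seteqP; split=> x; rewrite /N/= in_itv/= andbT lee_fin.
  have N0 : m (lim_sup_set N) = 0%E.
    apply: lim_sup_set_cvg0 => //.
    have := @epsilon_trick R (cst 0%E) 1 xpredT (fun=> lexx 0%E) ler01.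
    rewrite [X in (X + _)%E]eseries0// add0e => le1.
    apply: le_lt_trans (ltry 1); apply: le_trans le1; apply: lee_nneseries => // k _.
    by rewrite add0e; exact: projT2 (cid (close k)).
  have BA k x : ~ N k x -> B' x <-> A (n_ k) x.
    rewrite /N/= lee_fin => /negP; rewrite -ltNge ltr_norml => /andP[lo hi].
    rewrite /A/= in_itv/= andbT.
    split => [B'x|h]; move: lo hi; rewrite /f indicE.
      by rewrite mem_set//= => _; lra.
    by case: (boolP (x \in B')) => [/set_mem//|_] /=; lra.
  (* Almost every point lies in only finitely many [N k], and from then on it is in [B'] exactly
     when it is in [A (n_ k)]. *)
  have [D' mD' hD'] : ae_pullback m psi (lim_sup_set (fun k => A (n_ k))).
    rewrite /lim_sup_set -[\bigcap_n _]setCK setC_bigcap; apply: ae_pullbackC.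
    apply: ae_pullback_bigcup => i; apply: ae_pullbackC.
    rewrite bigcup_mkcond; apply: ae_pullback_bigcup => j.
    case: ifPn => _; first exact: psiA.
    by exists set0 => //; apply: aeW.
  exists D' => //.
  have aeN : {ae m, forall x, ~ lim_sup_set N x}.
    exists (lim_sup_set N); split => //; last by move=> x /= /contrapT.
    by apply: bigcapT_measurable => i; apply: bigcup_measurable.
  apply: filterS2 hD' aeN => x <- Nx.
  have [n nN] : exists n, forall k, (n <= k)%N -> ~ N k x.
    move: Nx => /existsNP[n /not_implyP[_ h]].
    by exists n => k nk Nk; apply: h; exists k.
  split => [B'x i _|h].
    exists (maxn i n); first by rewrite /= leq_maxl.
    by apply/BA => //; apply: nN; rewrite leq_maxr.
  by have [k /= nk Ak] := h n I; apply/BA; [exact: nN nk|].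
(* The pieces cover only the part of [B] inside [Y]; the rest is null for the restricted measure. *)
have : ae_pullback m psi (\bigcup_n (B `&` F n)).
  apply: ae_pullback_bigcup => n; apply: finite_case.
    by apply: measurableI => //; exact: (Foo n).1.
  apply: le_lt_trans (Foo n).2; rewrite /m/= /mrestr; apply: le_measure; rewrite ?inE.
  - by apply: measurableI => //; apply: measurableI => //; exact: (Foo n).1.
  - exact: (Foo n).1.
  - by move=> x [[]].
move=> [D mD hD]; exists D => //.
have aeY : {ae m, forall x, Y x} by apply/ae_mrestrP; exact: aeW.
apply: filterS2 hD aeY => x <-; rewrite {1}YF => -[n _ Fn].
by split => [Bx|[? _ []//]]; exists n.
Qed.

End separable_generation.

(** * Factoring functions through a map, and the uniform coordinate of one piece *)

Lemma ae_pullback_fun d (T : measurableType d) (R : realType) d' (U : measurableType d')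
    (mu : {measure set T -> \bar R}) (phi : T -> U) (f : T -> R) :
  (forall B, measurable B -> ae_pullback mu phi B) -> measurable_fun setT f ->
  exists2 h : U -> R, measurable_fun setT h & {ae mu, forall x, f x = h (phi x)}.
Proof.
move=> pb mf.
(* An enumeration of the rationals; numbers that code no rational give 0. The function [f] is
   rebuilt as the supremum of the rationals below it, each superlevel set being replaced by the
   preimage of some [D n]. *)
pose q n : R := ratr (odflt 0%R (choice.unpickle n)).
have {}pb n : ae_pullback mu phi (f @^-1` `]q n, +oo[).
  apply: pb; rewrite -[X in measurable X]setTI; apply: mf => //; exact: measurable_itv.
move: pb => /(_ _)/cid2 pb; pose D n := s2val (pb n).
have mD n : measurable (D n) by exact: s2valP (pb n).
pose g n t : \bar R := if t \in D n then (q n)%:E else -oo%E.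
have mg n : measurable_fun setT (g n).
  apply: measurable_fun_ifT => //; apply: (measurable_fun_bool true).
  rewrite setTI (_ : _ @^-1` _ = D n)//.
  by apply/seteqP; split=> x /=; [exact: set_mem|exact: mem_set].
exists (fun t => fine (esups (g ^~ t) 0%N)).
  apply: (measurableT_comp (fine_measurable _)) => //.
  exact: (measurable_fun_esups mg).
have : {ae mu, forall x, forall n, (f @^-1` `]q n, +oo[) x <-> D n (phi x)}.
  by apply: ae_foralln => n; exact: s2valP' (pb n).
apply: filterS => x h.
suff -> : esups (g ^~ (phi x)) 0%N = (f x)%:E by [].
apply/eqP; rewrite eq_le; apply/andP; split.
  apply: ge_ereal_sup => _ [n _ <-]; rewrite /g; case: ifPn => [/set_mem/h|_].
    by rewrite /= in_itv/= andbT lee_fin => /ltW.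
  exact: leNye.
apply/lee_addgt0Pr => e e0; rewrite -leeBlDr// -EFinB.
have /rat_in_itvoo[r] : f x - e < f x by rewrite ltrBlDr ltrDl.
rewrite in_itv/= => /andP[r1 r2].
have qr : q (choice.pickle r) = ratr r by rewrite /q choice.pickleK.
apply: (@le_trans _ _ (g (choice.pickle r) (phi x))).
  rewrite /g mem_set; first by rewrite qr lee_fin ltW.
  by apply/h; rewrite /= in_itv/= andbT qr.
by apply: ereal_sup_ubound; exists (choice.pickle r).
Qed.

Section uniform_coordinate.
Context d (T : measurableType d) (R : realType).
Variable nu : {measure set T -> \bar R}.

Lemma ae_null_dominated (m1 m2 : {measure set T -> \bar R}) (Q : set T) :
  (forall A, measurable A -> m1 A = 0%E -> m2 A = 0%E) ->
  {ae m1, forall x, Q x} -> {ae m2, forall x, Q x}.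
Proof. by move=> dom [N [mN N0 QN]]; exists N; split => //; exact: dom. Qed.

(** A fibre of positive measure would be an atom: every measurable set agrees almost everywhere on
    [Y] with a condition on [psi], hence contains almost all or almost none of the fibre. *)
Lemma pullback_fibre_null (Y : set T) (mY : measurable Y) (psi : T -> R) :
  restr_purely_nonatomic nu Y -> measurable_fun setT psi ->
  (forall B, measurable B -> ae_pullback (mrestr nu mY) psi B) ->
  forall t, nu (psi @^-1` [set t] `&` Y) = 0%E.
Proof.
move=> na mpsi pb t; set A := _ `&` Y.
have mA0 : measurable (psi @^-1` [set t]).
  by rewrite -[X in measurable X]setTI; apply: mpsi.
apply: contrapT => A0; apply: (na A); split; first by exists (psi @^-1` [set t]).
split; first by rewrite lt0e measure_ge0 andbT; exact/eqP.
move=> C mC CA; have [D mD /ae_mrestrP CD] := pb C mC.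
have mCY : measurable (C `&` Y) by exact: measurableI.
(* C is D o psi up to a null set, and psi is constant, equal to t, on A. *)
have [Dt|Dt] := pselect (D t); [right|left].
- have mA : measurable A by exact: measurableI.
  have ANC : nu (A `\` C) = 0%E.
    apply/negligibleP; first exact: measurableD.
    apply: negligibleS CD => x [[/= px Yx] nCx] /(_ Yx).
    by rewrite /= px => -[_ /(_ Dt)].
  rewrite -(measureU0 mCY (measurableD mA mC) ANC); congr (nu _).
  apply/seteqP; split => x; first by move=> [/CA|[]].
  by move=> Ax; have [Cx|nCx] := pselect (C x); [left; split => //; case: Ax|right].
- apply/negligibleP => //; apply: negligibleS CD => x CYx /(_ CYx.2) [/(_ CYx.1)].
  by have [-> _] := CA _ CYx.
Qed.

(** The probability [P] and [nu] restricted to [Y] have the same null sets, so almost everywhere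
    statements pass between them. The integral formula is the density of [P] followed by change of
    variables along [phi]. *)
Lemma separable_uniform_coordinate (Y : set T) : measurable Y ->
  sigma_finite Y nu -> separable_set nu Y -> (0 < nu Y)%E ->
  restr_purely_nonatomic nu Y ->
  exists (w : T -> R) (phi : T -> measurableTypeR R),
    [/\ measurable_fun setT w, (forall x, 0 < w x), measurable_fun setT phi,
      (forall h : measurableTypeR R -> \bar R, measurable_fun setT h ->
        (forall t, 0 <= h t)%E ->
        \int[nu]_(x in Y) ((w x)%:E * h (phi x)) = \int[leb01 R]_t h t)%E &
      (forall f : T -> R, measurable_fun setT f ->
        exists2 h : measurableTypeR R -> R, measurable_fun setT h &
          {ae nu, forall x, Y x -> f x = h (phi x)})].
Proof.
move=> mY sfY sepY nuY na.
have [w [P [mw w0 P0 Pint]]] := sigma_finite_probability_density mY sfY nuY.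
have [psi [mpsi psipb]] := separable_ae_generated mY sfY sepY.
pose X : {RV P >-> R} := HB.pack psi (isMeasurableFun.Build _ _ _ _ _ mpsi).
have nonatomic t : P (X @^-1` [set t]) = 0%E.
  apply/P0; first exact: measurable_funPTI.
  exact: (pullback_fibre_null na mpsi psipb).
have [phi [mphi law phipb]] := nonatomic_uniformisation nonatomic.
have PtoY Q : {ae P, forall x, Q x} -> {ae mrestr nu mY, forall x, Q x}.
  by apply: ae_null_dominated => A mA /(P0 _ mA).
have YtoP Q : {ae mrestr nu mY, forall x, Q x} -> {ae P, forall x, Q x}.
  by apply: ae_null_dominated => A mA ?; exact/(P0 _ mA).
exists w, phi; split => //.
- move=> h mh h0; rewrite -Pint//; last exact: measurableT_comp.
  pose phiM : {mfun T >-> measurableTypeR R} :=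
    HB.pack phi (isMeasurableFun.Build _ _ _ _ _ mphi).
  transitivity (\int[pushforward P phiM]_t h t)%E.
    by rewrite ge0_integral_pushforward.
  by apply: eq_measure_integral => A mA _; exact: law.
- move=> f mf.
  have [|h mh fh] := @ae_pullback_fun _ _ _ _ _ (mrestr nu mY) phi f _ mf.
    (* [B] is first expressed through [psi], and the resulting Borel condition on [psi] through
       [phi]. *)
    move=> B mB; have [D mD BD] := psipb B mB; have [D' mD' DD'] := phipb D mD.
    by exists D' => //; apply: PtoY; apply: filterS2 (YtoP _ BD) DD' => x -> /= ->.
  by exists h => //; exact/ae_mrestrP.
Qed.

End uniform_coordinate.

(** * Reduction of arbitrary families of pieces to countable ones *)

Lemma esum_lty_countable_support (R : realType) (J : choiceType) (a : J -> \bar R) :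
  (forall j, 0 <= a j)%E -> (\esum_(j in [set: J]) a j < +oo)%E ->
  countable [set j | a j != 0%E].
Proof.
move=> a0 aoo.
have -> : [set j | a j != 0%E] = \bigcup_n [set j | (n.+1%:R^-1)%:E <= a j]%E.
  apply/seteqP; split => [j /= aj|j [n _ /=] naj]; last first.
    by rewrite gt_eqF// (lt_le_trans _ naj)// lte_fin.
  have {}aj : (0 < a j)%E by rewrite lt0e aj a0.
  suff [n nj] : exists n, ((n.+1%:R^-1)%:E <= a j)%E by exists n.
  case: (a j) aj => [r|_|//]; last by exists 0%N; rewrite leey.
  rewrite lte_fin => r0; have [n nr] := ltr_add_invr r0.
  by exists n; rewrite lee_fin ltW// -[ltLHS]add0r.
apply: bigcup_countable => [|n _]; first exact: countableP.
apply: finite_set_countable; apply: contrapT => inf.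
have efin : (\esum_(j in [set: J]) a j)%E \is a fin_num by rewrite ge0_fin_numE// esum_ge0.
pose M := fine (\esum_(j in [set: J]) a j)%E.
(* Infinitely many terms of size at least [n.+1%:R^-1] would contain a finite subfamily whose sum
   exceeds the total [M]. *)
have [B BA Bn] := infinite_set_fset (Num.truncn (M * n.+1%:R)).+1 inf.
have : ((M%:E < (n.+1%:R^-1 *+ size (finmap.enum_fset B))%:E))%E.
  rewrite lte_fin -[ltRHS]mulr_natr mulrC ltr_pdivlMr//.
  by apply: lt_le_trans (truncnS_gt _) _; rewrite ler_nat.
rewrite fineK// ltNge => /negP; apply; apply: esum_ge.
exists [set` B] => //; rewrite fsbig_finite//= set_fsetK.
rewrite -[size (finmap.enum_fset B)]count_predT -[X in (X%:E <= _)%E]addr0.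
rewrite -iter_addr -big_const_seq.
rewrite -sumEFin big_seq [leRHS]big_seq; apply: lee_sum => j jB.
exact: BA.
Qed.

Section null_overlapping_families.
Context d (T : measurableType d) (R : realType) (J : choiceType).
Variables (nu : {measure set T -> \bar R}) (Xs : J -> set T).
Hypothesis mXs : forall j, measurable (Xs j).
Hypothesis nullXs : forall i j, i <> j -> nu (Xs i `&` Xs j) = 0%E.

(** The pieces are numbered by an injection and earlier ones are removed from later ones.
    Countability of [D] keeps the total loss null; a piece outside [D] meets the whole union in a
    null set for the same reason. *)
Lemma null_overlap_disjointification (D : set J) : countable D ->
  exists (c : J -> nat) (H : (set T)^nat),
  [/\ (forall n, measurable (H n)), trivIset setT H, set_inj D c &
     [/\ (forall j, D j -> H (c j) `<=` Xs j),
      (forall j, D j -> nu (Xs j `\` H (c j)) = 0%E),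
      (forall n, ~ (c @` D) n -> H n = set0),
      (\bigcup_n H n = \bigcup_(j in D) Xs j) &
      (forall j, ~ D j -> nu (Xs j `&` \bigcup_n H n) = 0%E)]].
Proof.
move=> /countable_injP[c cinj].
pose G n := \bigcup_(j in [set j | D j /\ c j = n]) Xs j.
have GE j : D j -> G (c j) = Xs j.
  move=> Dj; apply/seteqP; split => [x [i [Di ci] Xi]|x Xx]; last by exists j.
  by rewrite -(cinj _ _ _ _ ci)//; exact: mem_set.
have G0 n : ~ (c @` D) n -> G n = set0.
  by move=> nD; rewrite -subset0 => x [j [Dj cj] _]; apply: nD; exists j.
have mG n : measurable (G n).
  have [[j Dj <-]|/G0 ->//] := pselect ((c @` D) n); by rewrite GE.
have XGnull j n : ~ (D j /\ c j = n) -> nu.-negligible (Xs j `&` G n).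
  move=> nj; have [[i Di cin]|/G0 ->] := pselect ((c @` D) n); last first.
    by rewrite setI0; exact: negligible_set0.
  rewrite -cin GE//; apply/negligibleP; first exact: measurableI.
  by apply: nullXs => ji; apply: nj; rewrite ji.
have mH n : measurable (seqDU G n) by exact: seqDU_measurable.
exists c, (seqDU G); split => //.
split.
- by move=> j Dj; rewrite -(GE j Dj); exact: subset_seqDU.
- move=> j Dj; apply/negligibleP; first exact: measurableD.
  (* A point of [Xs j] is lost only to some [G i] with a smaller number. *)
  apply: (@negligibleS _ _ _ _ (\bigcup_(n in [set n | n <> c j]) (Xs j `&` G n))).
    move=> x [Xx /not_andP]; rewrite GE//= => -[//|/contrapT].
    rewrite -bigcup_mkord => -[i /= ilt Gi]; exists i => //.
    by move=> /= ic; move: ilt; rewrite ic ltnn.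
  rewrite bigcup_mkcond; apply: negligible_bigcup => n.
  case: ifPn => [/set_mem/= nc|_]; last exact: negligible_set0.
  by apply: XGnull => -[_ cj]; apply: nc.
- by move=> n /G0 Gn; rewrite -subset0 -Gn; exact: subset_seqDU.
- rewrite -seqDU_bigcup_eq; apply/seteqP; split => x.
    by move=> [n _ [j [Dj _] Xj]]; exists j.
  by move=> [j Dj Xj]; exists (c j) => //; exists j.
- move=> j nDj; apply/negligibleP.
    by apply: measurableI => //; exact: bigcup_measurable.
  rewrite -seqDU_bigcup_eq setI_bigcupr; apply: negligible_bigcup => n.
  by apply: XGnull => -[].
Qed.

(** Countable additivity applies to the disjoint sets [H n]. Passing from [H (c j)] back to [Xs j]
    changes no integral, and pieces outside [D] contribute zero. *)
Lemma integral_esum_null_overlap (D : set J) (u : T -> \bar R) : countable D ->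
  measurable_fun setT u -> (forall x, 0 <= u x)%E ->
  {ae nu, forall x, ~ (\bigcup_(j in D) Xs j) x -> u x = 0%E} ->
  (\int[nu]_x u x = \esum_(j in [set: J]) \int[nu]_(x in Xs j) u x)%E.
Proof.
move=> cD mu u0 aeu.
have [c [H [mH tH cinj [HX XH H0 UH offH]]]] := null_overlap_disjointification cD.
rewrite -UH in aeu.
have mUH : measurable (\bigcup_n H n) by exact: bigcup_measurable.
have int_null (A B : set T) : measurable A -> measurable B -> B `<=` A ->
    {ae nu, forall x, A x -> ~ B x -> u x = 0%E} ->
    (\int[nu]_(x in A) u x = \int[nu]_(x in B) u x)%E.
  move=> mA mB BA ae0.
  rewrite -{1}(setDUK BA) ge0_integral_setU//=; last 3 first.
  - exact: measurableD.
  - exact: measurable_funTS.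
  - by apply/disj_setPS => x [Bx []].
  rewrite [X in (_ + X)%E](_ : _ = 0%E) ?adde0//.
  rewrite (ge0_ae_eq_integral (g := cst 0%E))//; last 3 first.
  - exact: measurableD.
  - exact: measurable_funTS.
  - by apply: filterS ae0 => x h [Ax Bx]; exact: h.
  exact: integral0.
rewrite (int_null _ (\bigcup_n H n))//; last by apply: filterS aeu => x h _; exact: h.
rewrite ge0_integral_bigcup//; last exact: measurable_funTS.
rewrite nneseries_esumT; last by move=> n; exact: integral_ge0.
rewrite (_ : esum _ _ = \esum_(n in c @` D) \int[nu]_(x in H n) u x)%E; last first.
  rewrite [RHS]esum_mkcond; apply: eq_esum => n _; case: ifPn => // /negP nD.
  by rewrite H0 ?integral_set0// => cDn; apply: nD; exact: mem_set.
rewrite esum_image// esum_mkcond; apply: eq_esum => j _.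
case: ifPn => [/set_mem Dj|/negP nDj].
  rewrite (int_null _ _ (mXs j) (mH (c j)))//; first exact: HX.
  exists (Xs j `\` H (c j)); split; [exact: measurableD|exact: XH|].
  by move=> x /= /not_implyP[Xx /not_implyP[nH _]].
rewrite (int_null _ set0)// ?integral_set0//.
have off : {ae nu, forall x, ~ (Xs j `&` \bigcup_n H n) x}.
  exists (Xs j `&` \bigcup_n H n); split; [exact: measurableI| |by move=> x /contrapT].
  by apply: offH => Dj; apply: nDj; exact: mem_set.
by apply: filterS2 aeu off => x ux nH Xx _; apply: ux => Hx; apply: nH.
Qed.

End null_overlapping_families.

Section countable_support.
Context d (T : measurableType d) (R : realType) (J : choiceType).
Variables (nu : {measure set T -> \bar R}) (Xs : J -> set T).
Hypothesis mXs : forall j, measurable (Xs j).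
Hypothesis nullXs : forall i j, i <> j -> nu (Xs i `&` Xs j) = 0%E.
Hypothesis partXs : forall E, measurable E -> (nu E < +oo)%E ->
  nu E = \esum_(j in [set: J]) nu (E `&` Xs j).

(** By Markov each superlevel set [E n] has finite measure, so the partition identity lets it charge
    only countably many pieces. What is left of [E n] off these pieces meets every piece in a null
    set, and the same identity makes it null. *)
Lemma integrable_countable_support (u : T -> \bar R) :
  measurable_fun setT u -> (forall x, 0 <= u x)%E -> (\int[nu]_x u x < +oo)%E ->
  exists2 D : set J, countable D &
    {ae nu, forall x, ~ (\bigcup_(j in D) Xs j) x -> u x = 0%E}.
Proof.
move=> mu u0 uoo.
pose E n := [set x | (n.+1%:R^-1)%:E <= u x]%E.
have mE n : measurable (E n).
  rewrite (_ : E n = u @^-1` `[(n.+1%:R^-1)%:E, +oo[).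
    by rewrite -[X in measurable X]setTI; apply: mu => //; exact: emeasurable_itv.
  by apply/seteqP; split => x; rewrite /E/= in_itv/= andbT.
have Eoo n : (nu (E n) < +oo)%E.
  have n0 : 0 < n.+1%:R^-1 :> R by [].
  have := le_integral_abse nu measurableT mu n0; rewrite setTI.
  under eq_integral do rewrite gee0_abs//.
  move=> /le_lt_trans /(_ uoo); rewrite -/(E n).
  rewrite (_ : [set x | _] = E n).
    by case: (nu (E n)) (measure_ge0 nu (E n)) => // [r|]; rewrite ?ltry// gt0_muley ?lte_fin.
  by apply/seteqP; split=> x /=; rewrite gee0_abs.
pose Dn n := [set j | nu (E n `&` Xs j) != 0%E].
have cDn n : countable (Dn n).
  apply: esum_lty_countable_support => //.
  by rewrite -partXs.
have cD : countable (\bigcup_n Dn n) by apply: bigcup_countable.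
exists (\bigcup_n Dn n) => //.
have [c [H [mH _ _ [_ _ _ UH _]]]] := null_overlap_disjointification mXs nullXs cD.
rewrite -UH; set S := \bigcup_n H n.
have mS : measurable S by exact: bigcup_measurable.
have ES n : nu (E n `\` S) = 0%E.
  have mES : measurable (E n `\` S) by exact: measurableD.
  rewrite partXs//; last first.
    by apply: le_lt_trans (Eoo n); apply: le_measure; rewrite ?inE//; exact: subDsetl.
  apply: esum1 => j _; have [Dj|/negP nDj] := boolP (nu (E n `&` Xs j) != 0%E).
    rewrite (_ : _ `&` _ = set0) ?measure0// -subset0 => x [[_ nS] Xx].
    by apply: nS; rewrite /S UH; exists j => //; exists n.
  apply: (@subset_measure0 _ _ _ nu _ (E n `&` Xs j)).
  - exact: measurableI.
  - exact: measurableI.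
  - by apply: setSI; exact: subDsetl.
  - by apply/eqP/negPn/negP.
exists (\bigcup_n (E n `\` S)); split.
- by apply: bigcup_measurable => n _; exact: measurableD.
- apply/negligibleP; first by apply: bigcup_measurable => n _; exact: measurableD.
  apply: negligible_bigcup => n.
  by exists (E n `\` S); split => //; exact: measurableD.
- move=> x /= /not_implyP[nS /eqP ux].
  have {}ux : (0 < u x)%E by rewrite lt0e ux u0.
  suff [n nx] : exists n, ((n.+1%:R^-1)%:E <= u x)%E by exists n.
  case: (u x) ux => [r|_|//]; last by exists 0%N; rewrite leey.
  rewrite lte_fin => r0; have [n nr] := ltr_add_invr r0.
  by exists n; rewrite lee_fin ltW// -[ltLHS]add0r.
Qed.

End countable_support.

(** * Coordinates of L^p functions on the pieces, and their gluing *)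

Lemma Lp_funP d (T : measurableType d) (R : realType)
    (mu : {measure set T -> \bar R}) (p : R) (f : T -> R) : 0 < p ->
  Lp_fun mu p f <-> measurable_fun setT f /\
    (\int[mu]_x (`|(f x)%:E| `^ p) < +oo)%E.
Proof.
move=> p0; rewrite /Lp_fun /finite_norm; split=> -[mf fp]; split => //.
  rewrite -(poweR_Lnorm mu (EFin \o f)) ?gt_eqF//; exact: poweR_lty.
by rewrite unlock; exact: poweR_lty.
Qed.

Lemma measurable_abs_powe d (T : measurableType d) (R : realType) (p : R) (g : T -> R) :
  measurable_fun setT g -> measurable_fun setT (fun x => `|(g x)%:E| `^ p)%E.
Proof.
move=> mg; rewrite (_ : (fun x => _) = EFin \o (fun x => `|g x| `^ p))//.
apply/measurable_EFinP; apply: (measurableT_comp (measurable_powR p)).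
exact: measurableT_comp.
Qed.

Section weighted_coordinate.
Context d (T : measurableType d) (R : realType).
Variables (nu : {measure set T -> \bar R}) (p : R) (Y : set T).
Variables (w : T -> R) (phi : T -> measurableTypeR R).
Hypothesis p0 : 0 < p.
Hypothesis mY : measurable Y.
Hypothesis mw : measurable_fun setT w.
Hypothesis w0 : forall x, 0 < w x.
Hypothesis mphi : measurable_fun setT phi.
Hypothesis phi_int : forall h : measurableTypeR R -> \bar R,
  measurable_fun setT h -> (forall t, 0 <= h t)%E ->
  (\int[nu]_(x in Y) ((w x)%:E * h (phi x)) = \int[leb01 R]_t h t)%E.
Hypothesis phi_fun : forall f : T -> R, measurable_fun setT f ->
  exists2 h : measurableTypeR R -> R, measurable_fun setT h &
    {ae nu, forall x, Y x -> f x = h (phi x)}.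

(** A relation and not a map, since [h] is determined only up to a null set. The exponent of the
    weight makes its [p]-th power equal to [w], the density in the change of variables. *)
Definition lp_coord (f : T -> R) (h : measurableTypeR R -> R) : Prop :=
  measurable_fun setT h /\
  {ae nu, forall x, Y x -> f x = w x `^ p^-1 * h (phi x)}.

Lemma measurable_weight_root (q : R) : measurable_fun setT (fun x => w x `^ q).
Proof. by apply: (measurableT_comp (measurable_powR q)). Qed.

Lemma lp_coord_exists f : measurable_fun setT f -> exists h, lp_coord f h.
Proof.
move=> mf; have [|h mh fh] := @phi_fun (fun x => w x `^ (- p^-1) * f x).
  by apply: measurable_funM => //; exact: measurable_weight_root.
exists h; split => //; apply: filterS fh => x + Yx => /(_ Yx) <-.
by rewrite powRN mulrA mulfV ?mul1r// gt_eqF// powR_gt0.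
Qed.

Lemma lp_coord_integral f h : measurable_fun setT f -> lp_coord f h ->
  (\int[leb01 R]_t (`|(h t)%:E| `^ p) = \int[nu]_(x in Y) (`|(f x)%:E| `^ p))%E.
Proof.
move=> mf [mh fh].
rewrite -phi_int; last 2 first.
- exact: measurable_abs_powe.
- by move=> t; exact: poweR_ge0.
apply: ge0_ae_eq_integral => //.
- apply: measurable_funTS; apply: emeasurable_funM; first exact/measurable_EFinP.
  by apply: measurable_abs_powe; exact: measurableT_comp.
- by apply: measurable_funTS; exact: measurable_abs_powe.
- by move=> x _; rewrite mule_ge0// ?poweR_ge0// lee_fin ltW.
- by move=> x _; rewrite poweR_ge0.
apply: filterS fh => x + Yx => /(_ Yx) ->.
rewrite !poweR_EFin/= -EFinM; congr EFin.
rewrite normrM powRM// ger0_norm ?powR_ge0// -powRrM mulVf ?gt_eqF// powRr1//.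
by rewrite ltW.
Qed.

(** The integral formula is applied to the indicator of the set where [h] and [k] differ: as the
    weight is positive, [phi] avoids that set almost everywhere on [Y]. *)
Lemma lp_coord_unique f h k : lp_coord f h -> lp_coord f k ->
  h = k %[ae leb01 R].
Proof.
move=> [mh fh] [mk fk].
pose A := [set t | h t != k t].
have mA : measurable A.
  rewrite (_ : A = (fun t => h t - k t) @^-1` (~` [set 0])).
    rewrite -[X in measurable X]setTI; apply: measurable_funB => //.
    by apply: measurableC.
  by apply/funext => t; apply/propext; rewrite /A/= -subr_eq0; split=> /eqP.
exists A; split => //; last first.
  by move=> t /= /not_implyP[_ /eqP].
have m1 : measurable_fun setT (fun t : measurableTypeR R => (\1_A t : R)%:E).
  by apply/measurable_EFinP; exact: measurable_indic.
have := integral_indic (leb01 R) measurableT mA; rewrite setIT => <-.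
rewrite -(phi_int m1); last by move=> t; rewrite lee_fin.
rewrite (ge0_ae_eq_integral (g := cst 0%E))// ?integral0//.
- apply: measurable_funTS; apply: emeasurable_funM; first exact/measurable_EFinP.
  exact: (measurableT_comp m1).
- by move=> x _; rewrite mule_ge0// lee_fin// ltW.
apply: filterS2 fh fk => x + + Yx => /(_ Yx) -> /(_ Yx) hk.
rewrite indicE memNset ?mule0//= /A/= => /negP; apply.
by apply/eqP; apply: mulfI hk; rewrite gt_eqF// powR_gt0.
Qed.

Lemma lp_coordD f g h k (a : R) : lp_coord f h -> lp_coord g k ->
  lp_coord (fun x => f x + a * g x) (fun t => h t + a * k t).
Proof.
move=> [mh fh] [mk gk]; split.
  by apply: measurable_funD => //; exact: measurable_funM.
apply: filterS2 fh gk => x + + Yx => /(_ Yx) -> /(_ Yx) ->.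
by rewrite mulrDr mulrCA.
Qed.

Lemma eq_lp_coord f g h : f = g %[ae nu] -> lp_coord f h -> lp_coord g h.
Proof.
move=> fg [mh fh]; split => //.
by apply: filterS2 fg fh => x + + Yx => /(_ I) <- /(_ Yx).
Qed.

End weighted_coordinate.

(** The weighted pullback of [g j] is placed on the disjoint set [H (c j)], and zero elsewhere. Null
    differences do not affect coordinates, so the original pieces see the intended functions. This
    provides the preimages for surjectivity. *)
Lemma lp_coord_glue d (T : measurableType d) (R : realType) (J : choiceType)
    (nu : {measure set T -> \bar R}) (Xs : J -> set T) (p : R)
    (w : J -> T -> R) (phi : J -> T -> measurableTypeR R)
    (D : set J) (g : J -> measurableTypeR R -> R) :
  (forall j, measurable (Xs j)) ->
  (forall i j, i <> j -> nu (Xs i `&` Xs j) = 0%E) ->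
  (forall j, measurable_fun setT (w j)) ->
  (forall j, measurable_fun setT (phi j)) ->
  (forall j, measurable_fun setT (g j)) -> countable D ->
  exists f : T -> R, [/\ measurable_fun setT f,
    (forall x, ~ (\bigcup_(j in D) Xs j) x -> f x = 0),
    (forall j, D j -> lp_coord nu p (Xs j) (w j) (phi j) f (g j)) &
    (forall j, ~ D j -> lp_coord nu p (Xs j) (w j) (phi j) f (cst 0))].
Proof.
move=> mXs nullXs mw mphi mg cD.
have [c [H [mH tH cinj [HX XH H0 UH offH]]]] :=
  null_overlap_disjointification mXs nullXs cD.
pose u n x := if pselect ((c @` D) n) is left h
  then let j := s2val (cid2 h) in w j x `^ p^-1 * g j (phi j x) else 0.
have mu n : measurable_fun setT (u n).
  rewrite /u; case: pselect => [h|_]; last exact: measurable_cst.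
  case: cid2 => j Dj cj /=; apply: measurable_funM.
    exact: (measurableT_comp (measurable_powR _)).
  exact: (measurableT_comp (mg j)).
have uE j x : D j -> u (c j) x = w j x `^ p^-1 * g j (phi j x).
  move=> Dj; rewrite /u; case: pselect => [h|[]]; last by exists j.
  case: cid2 => i Di ci /=; suff -> : i = j by [].
  by apply: cinj => //; exact: mem_set.
have [f [mf fu fN]] := measurable_glue (0 : R) mH tH mu.
exists f; split => //; first by move=> x; rewrite -UH; exact: fN.
- move=> j Dj; split => //.
  exists (Xs j `\` H (c j)); split; [exact: measurableD|exact: XH|].
  move=> x /= /not_implyP[Xx fx]; split => // Hx; apply: fx.
  by rewrite (fu (c j))// uE.
- move=> j nDj; split; first exact: measurable_cst.
  exists (Xs j `&` \bigcup_n H n); split; [|exact: offH|].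
    by apply: measurableI => //; exact: bigcup_measurable.
  move=> x /= /not_implyP[Xx fx]; split => //; apply: contrapT => nH; apply: fx.
  by rewrite fN// mulr0.
Qed.

(** * Assembly of the isometry *)

Theorem theorem4p3 (d : measure_display) (X : measurableType d) (R : realType)
  (nu : {measure set X -> \bar R}) (p : R) (J : choiceType)
  (Xs : J -> set X) :
  1 <= p -> relatively_nonatomic nu -> separable_partition nu Xs ->
  exists Phi : (X -> R) -> J -> measurableTypeR R -> R, Lp_lp_isometric_iso nu p Phi.
Proof.
move=> p1 rna [mXs [sfXs [sepXs [posXs [nullXs partXs]]]]].
have p0 : 0 < p by exact: lt_le_trans p1.
have pN0 : p != 0 by rewrite gt_eqF.
have coord j := separable_uniform_coordinate (mXs j) (sfXs j) (sepXs j) (posXs j)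
  (rna _ (mXs j) (sfXs j)).
have [w {}coord] := choice coord; have [phi {}coord] := choice coord.
pose C j := lp_coord nu p (Xs j) (w j) (phi j).
(* A coordinate exists for every measurable [f]; the zero function is only a default. Linearity and
   compatibility with almost everywhere equality come from uniqueness of coordinates. *)
pose Phi f j := if pselect (exists h, C j f h) is left e
  then projT1 (cid e) else cst 0.
have PhiC f j : measurable_fun setT f -> C j f (Phi f j).
  move=> mf; rewrite /Phi; case: pselect => [e|[]]; first by case: cid.
  by have [mw w0 _ _ pf] := coord j; exact: lp_coord_exists.
have C_uniq j f h k : C j f h -> C j f k -> h = k %[ae leb01 R].
  by have [mw w0 mphi pint _] := coord j; exact: lp_coord_unique.
have C_int j f h : measurable_fun setT f -> C j f h ->
    (\int[leb01 R]_t (`|(h t)%:E| `^ p) = \int[nu]_(x in Xs j) (`|(f x)%:E| `^ p))%E.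
  by have [mw w0 mphi pint _] := coord j; exact: lp_coord_integral.
have LnormE f j : measurable_fun setT f -> (Lnorm (leb01 R) p%:E (EFin \o Phi f j) `^ p =
    \int[nu]_(x in Xs j) (`|(f x)%:E| `^ p))%E.
  by move=> mf; rewrite poweR_Lnorm//; apply: C_int => //; exact: PhiC.
have total f : Lp_fun nu p f ->
    (\int[nu]_x (`|(f x)%:E| `^ p) =
      \esum_(j in [set: J]) (Lnorm (leb01 R) p%:E (EFin \o Phi f j) `^ p))%E.
  move=> /(Lp_funP _ _ p0)[mf foo].
  have mfp := measurable_abs_powe p mf.
  have fp0 x : (0 <= `|(f x)%:E| `^ p)%E by exact: poweR_ge0.
  (* The [p]-th power of [f] is integrable, hence carried by countably many pieces, where integrals
     add up. *)
  have [D cD fD] := integrable_countable_support mXs nullXs partXs mfp fp0 foo.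
  rewrite (integral_esum_null_overlap mXs nullXs cD mfp fp0 fD).
  by apply: eq_esum => j _; rewrite LnormE.
exists Phi; split; [|split; [|split; [|split]]].
- move=> f Lf; have /(Lp_funP _ _ p0)[mf foo] := Lf; split; last by rewrite -total.
  move=> j; apply/(Lp_funP _ _ p0); split; first by have [] := PhiC f j mf.
  rewrite (C_int j f)//; last exact: PhiC.
  apply: le_lt_trans foo; apply: ge0_subset_integral => //.
    exact: measurable_abs_powe.
  by move=> x _; exact: poweR_ge0.
- move=> f g a [mf _] [mg _] j; apply: (C_uniq j (fun x => f x + a * g x)).
    by apply: PhiC; apply: measurable_funD => //; exact: measurable_funM.
  by apply: lp_coordD; exact: PhiC.
- move=> f g [mf _] [mg _] fg j; apply: (C_uniq j g); last exact: PhiC.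
  by apply: eq_lp_coord fg _; exact: PhiC.
- by move=> f Lf; rewrite /lp_norm -total// unlock.
- move=> g [gL goo].
  have mg j : measurable_fun setT (g j) by have [] := gL j.
  set a := fun j => (Lnorm (leb01 R) p%:E (EFin \o g j) `^ p)%E in goo.
  have a0 j : (0 <= a j)%E by exact: poweR_ge0.
  (* Only countably many components have nonzero norm, and these are glued. The others vanish almost
     everywhere and match the zero coordinate of the glued function. *)
  pose D := [set j | a j != 0%E].
  have cD : countable D by exact: esum_lty_countable_support.
  have [f [mf fN fD fND]] := @lp_coord_glue _ _ _ _ nu Xs p w phi D g mXs nullXs
    (fun j => let: And5 mw _ _ _ _ := coord j in mw)
    (fun j => let: And5 _ _ mphi _ _ := coord j in mphi) mg cD.
  have gND j : ~ D j -> g j = cst 0 %[ae leb01 R].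
    move=> /negP; rewrite negbK => /eqP /(poweR_eq0_eq0 (Lnorm_ge0 _ _ _)) gj0.
    have mgj : measurable_fun setT (EFin \o g j) by exact/measurable_EFinP.
    have p0E : (0 < p%:E)%E by rewrite lte_fin.
    by apply: filterS (Lnorm_eq0_eq0 mgj p0E gj0) => t /(_ I) [].
  exists f.
    apply/(Lp_funP _ _ p0); split => //.
    rewrite (integral_esum_null_overlap mXs nullXs cD); last 3 first.
    + exact: measurable_abs_powe.
    + by move=> x; exact: poweR_ge0.
    + by apply: aeW => x /fN ->; rewrite abse0 poweR0r.
    rewrite (_ : esum _ _ = \esum_(j in [set: J]) a j)//; apply: eq_esum => j _.
    have [Dj|nDj] := pselect (D j).
      by rewrite -(C_int _ _ _ mf (fD j Dj)) /a poweR_Lnorm.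
    rewrite -(C_int _ _ _ mf (fND j nDj)) integral0_eq => [|t _]; last first.
      by rewrite /= normr0 powR0.
    by move: nDj => /negP; rewrite negbK => /eqP.
  move=> j; have [Dj|nDj] := pselect (D j).
    by apply: (C_uniq j f); [exact: PhiC|exact: fD].
  apply: ae_eq_trans (ae_eq_sym (gND j nDj)).
  by apply: (C_uniq j f); [exact: PhiC|exact: fND].
Qed.
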